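(* There is a constant $C>0$ such that for every sufficiently large $h$, the complete binary tree $Bt_h$ with $n=2^h-1$ nodes admits a persistent reversible pebbling that uses exactly $\mathrm{rev}(Bt_h)$ pebbles (i.e., is optimal) and takes at most $n^{C\log\log n}$ steps; that is, optimal pebblings of $Bt_h$ taking $n^{O(\log\log n)}$ steps exist.
   Context: $Bt_h$ denotes the complete binary tree of height $h$ (height = number of nodes on a root-to-leaf path), with edges directed from child to parent, so the root is the unique sink. A persistent reversible pebbling of a directed acyclic graph $G$ with unique sink $r$ is a sequence $P_1,\dots,P_m$ of vertex subsets with $P_1=\emptyset$, $P_m=\{r\}$, such that each $P_i$ ($i\ge2$) is obtained from $P_{i-1}$ by adding or removing exactly one vertex $v$, all of whose in-neighbours lie in $P_{i-1}$. Its number of pebbles is $\max_i|P_i|$, its number of steps (time) is $m$, and $\mathrm{rev}(G)$ is the minimum number of pebbles over all such pebblings. *)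

(* Defs.v *)
From mathcomp Require Import all_boot.
From mathcomp Require Import boolp.

Set Implicit Arguments.
Unset Strict Implicit.
Unset Printing Implicit Defensive.

(* [edge u v] is the arc u -> v, so the in-neighbours of v are the u with
   [edge u v]. *)
Record dag := Dag {
  vertex :> finType;
  edge : rel vertex;
  sink : vertex;
  dag_acyclic : forall p : seq vertex, cycle edge p -> p = [::];
  dag_unique_sink : forall v : vertex,
    (forall w : vertex, ~~ edge v w) <-> v = sink
}.
Arguments edge {d}.
Arguments sink {d}.

Section Pebbling.
Variable G : dag.
Implicit Types (A B D : {set G}) (P : seq {set G}).

Definition pebble_move A B : bool :=
  [exists v : G,
    ((v \notin A) && (B == v |: A) || (v \in A) && (B == A :\ v))
    && [forall u : G, edge u v ==> (u \in A)]].

Definition persistent_pebbling P : bool :=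
  if P is A :: P' then
    [&& A == set0, path pebble_move A P' & last A P' == [set sink]]
  else false.

Definition pebbles P : nat := \max_(A <- P) #|A|.

Definition steps P : nat := size P.

(* Every dag with a unique sink has a persistent pebbling: fill the graph in
   topological order, then empty it, except for the sink, in reverse order. *)
Let rank (x : G) := #|[set u : G | connect edge u x]|.

Let rank_edge (u v : G) : edge u v -> rank u < rank v.
Proof.
move=> uv; apply/proper_card/properP; split.
  apply/subsetP => w; rewrite !inE => wu.
  exact: connect_trans wu (connect1 uv).
exists v; rewrite !inE ?connect0 //; apply/negP => /connectP[p vp u_last].
suff: v :: p = [::] by [].
by apply: (@dag_acyclic G); rewrite /= rcons_path vp -u_last.
Qed.

Let down D := forall u v : G, edge u v -> v \in D -> u \in D.

Let down_top D : down D -> D != set0 ->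
  exists x, [/\ x \in D, down (D :\ x) & forall u, edge u x -> u \in D :\ x].
Proof.
move=> dD /set0Pn[y yD]; case: (arg_maxnP rank yD) => x xD x_max.
exists x; split=> // [u v uv|u ux]; last first.
  rewrite in_setD1 (dD _ _ ux xD) andbT.
  by apply: contraTneq (rank_edge ux) => ->; rewrite ltnn.
rewrite !in_setD1 => /andP[_ vD]; rewrite (dD _ _ uv vD) andbT.
apply: contraTneq (rank_edge uv) => ->.
by rewrite -leqNgt; apply: x_max.
Qed.

Let fill n D : #|D| = n -> down D -> connect pebble_move set0 D.
Proof.
elim: n D => [|n IHn] D cD dD; first by rewrite (cards0_eq cD) connect0.
have D0 : D != set0 by rewrite -card_gt0 cD.
have [x [xD dDx inx]] := down_top dD D0.
apply: connect_trans (IHn _ _ dDx) (connect1 _).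
  by move: cD; rewrite (cardsD1 x) xD add1n => -[].
apply/existsP; exists x; rewrite !inE eqxx /= setD1K // eqxx /=.
by apply/forallP => u; apply/implyP/inx.
Qed.

Let drain n D : #|D| = n -> down D ->
  connect pebble_move (sink |: D) [set sink].
Proof.
elim: n D => [|n IHn] D cD dD.
  by rewrite (cards0_eq cD) setU0 connect0.
have D0 : D != set0 by rewrite -card_gt0 cD.
have [x [xD dDx inx]] := down_top dD D0.
have cDx : #|D :\ x| = n by move: cD; rewrite (cardsD1 x) xD add1n => -[].
have [x_sink|x_sink] := eqVneq x sink.
  have := IHn _ cDx dDx; rewrite -x_sink setD1K //.
  by rewrite (setUidPr _) // sub1set.
apply: connect_trans (connect1 _) (IHn _ cDx dDx).
apply/existsP; exists x; rewrite !inE xD orbT /=; apply/andP; split.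
  apply/eqP/setP => y; rewrite !inE.
  by have [->|] := eqVneq y x; rewrite ?(negPf x_sink).
apply/forallP => u; apply/implyP => /inx; rewrite !inE => /andP[_ ->].
exact: orbT.
Qed.

Lemma persistent_pebbling_exists : exists P, persistent_pebbling P.
Proof.
have dT : down setT by move=> u v _ _; rewrite inE.
have := connect_trans (fill erefl dT).
move/(_ [set sink]); have := drain erefl dT.
rewrite setUT => dr /(_ dr) /connectP[p pp pl].
by exists (set0 :: p); rewrite /= eqxx pp -pl eqxx.
Qed.

Lemma pebbles_value_exists :
  exists k, `[< exists2 P, persistent_pebbling P & pebbles P = k >].
Proof.
have [P PP] := persistent_pebbling_exists.
by exists (pebbles P); apply/asboolP; exists P.
Qed.

Definition rev_number : nat := ex_minn pebbles_value_exists.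

Lemma rev_numberP :
  (exists2 P, persistent_pebbling P & pebbles P = rev_number) /\
  (forall P, persistent_pebbling P -> rev_number <= pebbles P).
Proof.
rewrite /rev_number; case: ex_minnP => k /asboolP kP k_min; split=> // P PP.
by apply/k_min/asboolP; exists P.
Qed.

End Pebbling.

Section CompleteBinaryTree.
Variable h : nat.

(* A node is the bit string leading to it from the root, deepest choice first;
   the root is the empty string.  Height h counts nodes, so strings have length
   at most h - 1.  For h = 0 this is the one-node tree of height 1. *)
Let node := (h.-1).-bseq bool.

Definition Bt_edge (c p : node) : bool :=
  [exists b : bool, val c == b :: val p].

Let root : node := [bseq].

Let size_path (x : node) q :
  path Bt_edge x q -> size (last x q) + size q = size x.
Proof.
elim: q x => [|y q IHq] x /=; first by rewrite addn0.
by case/andP=> /existsP[b /eqP xE] /IHq yE; rewrite xE /= -yE addnS.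
Qed.

Lemma Bt_acyclic (q : seq node) : cycle Bt_edge q -> q = [::].
Proof.
case: q => //= x q /size_path; rewrite last_rcons size_rcons => /eqP.
by rewrite -{2}[size x]addn0 eqn_add2l.
Qed.

Lemma Bt_unique_sink (v : node) : (forall w, ~~ Bt_edge v w) <-> v = root.
Proof.
split=> [vS|-> w]; last by apply/existsP => -[].
case: v vS => -[|b s] sP vS; first exact: val_inj.
have := vS (Bseq (ltnW sP : size s <= h.-1)).
by case/existsP; exists b.
Qed.

Definition Bt : dag := Dag Bt_acyclic Bt_unique_sink.

End CompleteBinaryTree.

Lemma card_Bt h : 0 < h -> #|Bt h| = 2 ^ h - 1.
Proof.
case: h => // h _; rewrite (bij_eq_card (@bseq_tagged_tuple_bij h bool)).
rewrite card_tagged sumnE big_map big_enum /=.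
under eq_bigr do rewrite card_tuple card_bool.
by rewrite subn1 predn_exp mul1n.
Qed.

(* Main.v *)
Require Import Defs.
From mathcomp Require Import all_boot all_order all_algebra.
From mathcomp Require Import reals sequences exp.
From mathcomp Require Import zify.
Import Order.TTheory GRing.Theory Num.Theory.

(* For a tree U with root r, an optimal persistent pebbling may be taken to fill
   the in-neighbours of r, place a pebble on r and then undo the first phase; so
   only the visits of the in-neighbours of r within U minus r matter.  Consider
   such a visit using K pebbles whose pebble counts have the least sum over time,
   and let l be the first leaf pebbled.  Let v be the lowest ancestor of l whose
   subtree U_v is never empty again.  Then the rest of the visit pebbles U minus U_v with at
   most K - 1 pebbles at a time.  If w is the child of v above l, then U_w is
   emptied at some time b, which by minimality happens after v has been pebbled
   with the help of w.  Also by minimality, v is placed only after the last time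
   at which all pebbles lie properly below v, so from then on at most K - 1 do.
   Joining the visit up to b, without U_w, to the reversed visit from b back to
   the placement of v gives a visit of the children of v with K - 1 pebbles.

   Thus some edge cuts U into two trees that both need one pebble less.  Pebbling
   v, then r, then unpebbling v costs three recursive calls, so rev(G) pebbles and
   about 3^rev(G) moves suffice.  As rev(Bt_h) < 2h, this is polynomial in n. *)

Set Implicit Arguments.
Unset Strict Implicit.
Unset Printing Implicit Defensive.

(** * Pebble moves inside a vertex set *)

Section Moves.
Variable G : dag.
Implicit Types (A B D U W X Z : {set G}) (u v w x y z r : G).

Lemma edge_irrefl v : ~~ edge v v.
Proof.
apply/negP => vv; suff: [:: v] = [::] by [].
by apply: (@dag_acyclic G); rewrite /= vv.
Qed.

Lemma edge_connect_false u v : edge u v -> ~~ connect edge v u.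
Proof.
move=> uv; apply/negP => /connectP[p vp u_last].
suff: v :: p = [::] by [].
by apply: (@dag_acyclic G); rewrite /= rcons_path vp -u_last.
Qed.

Lemma connect_anti u v : connect edge u v -> connect edge v u -> u = v.
Proof.
case/connectP=> -[|w p] /=; first by move=> _ ->.
case/andP=> uw wp -> vu; have := edge_connect_false uw.
by rewrite (connect_trans _ vu) //; apply/connectP; exists p.
Qed.

(** Placing and removing are one case, a toggle at [z], which makes symmetry easy. Only
    in-neighbours inside [U] are required, so a subtree is pebbled as a graph of its own. *)
Definition move_in U A B :=
  [exists z in U, [forall y, (y \in B) == (y \in A) (+) (y == z)]
     && [forall u in U, edge u z ==> (u \in A)]].

Lemma move_inP U A B :
  reflect (exists z, [/\ z \in U, forall y, (y \in B) = (y \in A) (+) (y == z)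
                       & forall u, u \in U -> edge u z -> u \in A])
          (move_in U A B).
Proof.
apply: (iffP exists_inP) => [[z zU /andP[/forallP Bz /forall_inP inz]]|].
  by exists z; split=> // [y|u uU]; [apply/eqP | apply/implyP/inz].
case=> z [zU Bz inz]; exists z => //; apply/andP; split.
  by apply/forallP => y; rewrite Bz.
by apply/forall_inP => u uU; apply/implyP/inz.
Qed.

Lemma move_inC U : symmetric (move_in U).
Proof.
suff sym A B : move_in U A B -> move_in U B A by move=> A B; apply/idP/idP => /sym.
case/move_inP=> z [zU Bz inz]; apply/move_inP; exists z; split=> // [y|u uU uz].
  by rewrite Bz addbK.
rewrite Bz inz //; case: eqP uz => // -> zz.
by have := edge_irrefl z; rewrite zz.
Qed.

Lemma move_in_sub U A B : move_in U A B -> A \subset U -> B \subset U.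
Proof.
case/move_inP=> z [zU Bz _] /subsetP sAU; apply/subsetP => y.
by rewrite Bz; case: eqP => [->|_] //; rewrite addbF => /sAU.
Qed.

Lemma pebble_moveE A B : pebble_move A B = move_in setT A B.
Proof.
apply/existsP/move_inP => -[z].
  case/andP=> AB /forallP inz; exists z; split=> // [y|u _]; last exact/implyP.
  case/orP: AB => /andP[zA /eqP->]; rewrite !inE.
    by case: eqP => [->|_]; [rewrite (negPf zA) | rewrite addbF].
  by case: eqP => [->|_]; [rewrite zA | rewrite addbF].
case=> _ Bz inz; exists z; apply/andP; split; last first.
  by apply/forallP => u; apply/implyP/inz.
have [zA|zA] := boolP (z \in A); rewrite /= ?orbF; apply/eqP/setP=> y; rewrite !inE Bz.
  by case: eqP => [->|_]; [rewrite zA | rewrite addbF].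
by case: eqP => [->|_]; [rewrite (negPf zA) | rewrite addbF].
Qed.

(** Pauses let a visit be restricted to part of the tree without reindexing time. *)
Definition lazy_move W A B := (A == B) || move_in W A B.

Lemma lazy_move_in W A B z : lazy_move W A B -> z \notin A -> z \in B ->
  forall u, u \in W -> edge u z -> u \in A.
Proof.
case/orP=> [/eqP->|/move_inP[y [_ By iny]]]; first by move=> /negPf->.
by rewrite By => /negPf-> /= /eqP->.
Qed.

(** A move outside [X] becomes a pause; a move inside [X] stays legal because the in-neighbours it
    needs in [W'] survive the restriction. *)
Lemma lazy_moveI W W' X A B : lazy_move W A B ->
  (forall z, z \in W -> z \in X -> (z \in A) != (z \in B) ->
     z \in W' /\ forall u, u \in W' -> edge u z -> (u \in W) && (u \in X)) ->
  lazy_move W' (A :&: X) (B :&: X).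
Proof.
case/orP=> [/eqP-> _|/move_inP[z [zW Bz inz]] restr]; first by rewrite /lazy_move eqxx.
have [zX|zX] := boolP (z \in X); last first.
  apply/orP; left; apply/eqP/setP => y; rewrite !inE Bz.
  by case: eqP => [->|_]; [rewrite (negPf zX) !andbF | rewrite addbF].
have := restr z zW zX; rewrite Bz eqxx addbT.
case=> [|zW' predz]; first by case: (z \in A).
apply/orP; right; apply/move_inP; exists z; split=> // [y|u uW' uz].
  by rewrite !inE Bz; case: eqP => [->|_]; rewrite ?zX ?andbT ?addbF.
by have /andP[uW uX] := predz u uW' uz; rewrite inE uX inz.
Qed.

Definition small_move W K A B := [&& move_in W A B, #|A| <= K & #|B| <= K].

Lemma small_connectC W K : connect_sym (small_move W K).
Proof.
by apply: sym_connect_sym => A B; rewrite /small_move move_inC [X in _ && X]andbC.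
Qed.

Lemma lazy_moves_connect W K (Q : nat -> {set G}) a b : a <= b ->
  (forall t, a <= t < b -> lazy_move W (Q t) (Q t.+1)) ->
  (forall t, a <= t <= b -> #|Q t| <= K) -> connect (small_move W K) (Q a) (Q b).
Proof.
elim: b => [|b IH]; first by rewrite leqn0 => /eqP->.
rewrite leq_eqVlt => /predU1P[-> //|ab] mv sm.
have ab' : a <= b by [].
have {}IH : connect (small_move W K) (Q a) (Q b).
  apply: IH => // t /andP[at_ tb]; [apply: mv|apply: sm]; rewrite at_ /=; exact: leqW.
have /orP[/eqP<- //|m] : lazy_move W (Q b) (Q b.+1) by apply: mv; rewrite ab' /=.
apply: connect_trans IH (connect1 _).
by rewrite /small_move m !sm // ?leqnn ?leqnSn ?ab' //= leqW.
Qed.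

Lemma small_connect_moves W K B : connect (small_move W K) set0 B ->
  exists Q N, [/\ Q 0 = set0, Q N = B,
    forall t, t < N -> lazy_move W (Q t) (Q t.+1),
    forall t, t <= N -> Q t \subset W & forall t, t <= N -> #|Q t| <= K].
Proof.
case/connectP=> p /(pathP set0) mv ->.
exists (nth set0 (set0 :: p)), (size p); split=> //.
- by rewrite nth_last.
- by move=> t /mv/and3P[m _ _]; apply/orP; right.
- elim=> [|t IH] tp; first exact: sub0set.
  have /and3P[m _ _] := mv t tp; exact: move_in_sub m (IH (ltnW tp)).
case=> [|t] tp; first by rewrite cards0.
by have /and3P[] := mv t tp.
Qed.

(** Unlike [connect (small_move U k)], this also bounds the number of moves. *)
Definition pebbling U k n A B := exists p,
  [/\ path (move_in U) A p, last A p = B, all (fun D : {set G} => #|D| <= k) (A :: p)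
    & size p <= n].

Lemma pebbling_leq U k k' n n' A B : k <= k' -> n <= n' ->
  pebbling U k n A B -> pebbling U k' n' A B.
Proof.
move=> kk nn [p [Ap lp sp np]]; exists p; split=> //; last exact: leq_trans nn.
by apply: sub_all sp => D /leq_trans; apply.
Qed.

Lemma pebbling_trans U k n n' A B D :
  pebbling U k n A B -> pebbling U k n' B D -> pebbling U k (n + n') A D.
Proof.
move=> [p [Ap <- sp np]] [q [Bq <- /= /andP[_ sq] nq]]; exists (p ++ q); split.
- by rewrite cat_path Ap.
- by rewrite last_cat.
- by rewrite -cat_cons all_cat sp.
- by rewrite size_cat leq_add.
Qed.

Lemma pebblingC U k n A B : pebbling U k n A B -> pebbling U k n B A.
Proof.
move=> [p [Ap <- sp np]]; exists (rev (belast A p)); split.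
- by rewrite rev_path; apply: sub_path Ap => D D'; rewrite move_inC.
- by case: p {Ap sp np} => //= D p; rewrite rev_cons last_rcons.
- by rewrite -rev_rcons -lastI all_rev.
- by rewrite size_rev size_belast.
Qed.

(* The pebbles of [Z] stay put and supply the in-neighbours missing from [X]. *)
Lemma pebbling_lift X U Z k n A B : X \subset U -> [disjoint X & Z] ->
  (forall z u, z \in X -> u \in U -> edge u z -> (u \in X) || (u \in Z)) ->
  pebbling X k n A B -> pebbling U (#|Z| + k) n (Z :|: A) (Z :|: B).
Proof.
move=> XU XZ closed [p [Ap <- sp np]]; exists (map (setU Z) p); split.
- elim: p A Ap {sp np} => //= D p IH A /andP[AD Dp]; rewrite IH // andbT.
  have /move_inP[z [zX Dz inz]] := AD; apply/move_inP; exists z; split.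
  + exact: (subsetP XU).
  + have zZ := disjointFr XZ zX.
    by move=> y; rewrite !inE Dz; case: eqP => [->|_]; rewrite ?zZ ?addbF.
  + move=> u uU uz; rewrite !inE orbC.
    by have /orP[uX|->] := closed z u zX uU uz; rewrite ?orbT // inz.
- by rewrite last_map.
- rewrite -map_cons all_map; apply: sub_all sp => D /= sD.
  by rewrite (leq_trans (leq_card_setU Z D)) // leq_add2l.
- by rewrite size_map.
Qed.

End Moves.

(** * Rooted subtrees when every vertex has at most one out-edge *)

Section Trees.
Variable G : dag.
Hypothesis out_unique : forall v w w' : G, edge v w -> edge v w' -> w = w'.
Implicit Types (A B D U W X Z : {set G}) (u v w x y z r : G).

(** The last clause keeps the path from [x] to [r] inside [U], so that [connect] in the whole graph
    agrees with ancestry in [U]. *)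
Definition rooted U r :=
  [/\ r \in U, forall x, x \in U -> connect edge x r
    & forall x, x \in U -> x != r -> exists2 p, p \in U & edge x p].

Definition below U v := U :&: [set u | connect edge u v].

Definition children U v := [set u in U | edge u v].

Lemma connect_parent u v z : connect edge u v -> u != v -> edge u z -> connect edge z v.
Proof.
case/connectP=> -[|y p] /= => [_ ->|]; first by rewrite eqxx.
by case/andP=> uy yp -> _ /(out_unique uy) <-; apply/connectP; exists p.
Qed.

Lemma edge_neq u v : edge u v -> u != v.
Proof. by apply: contraTneq => ->; apply: edge_irrefl. Qed.

Lemma rooted_below U r v : rooted U r -> v \in U -> rooted (below U v) v.
Proof.
move=> [_ toroot par] vU; split; first by rewrite !inE vU connect0.
  by move=> x; rewrite !inE => /andP[].
move=> x; rewrite !inE => /andP[xU xv] xnv; have [xr|xnr] := eqVneq x r.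
  by case/eqP: xnv; apply: connect_anti => //; rewrite xr toroot.
have [p pU xp] := par x xU xnr; exists p => //.
by rewrite !inE pU (connect_parent xv).
Qed.

Lemma below_root U r v : rooted U r -> v \in U -> v != r -> r \notin below U v.
Proof.
move=> [_ toroot _] vU vr; rewrite !inE; apply: contra_neqN vr => /andP[_ rv].
by apply: connect_anti => //; apply: toroot.
Qed.

Lemma rooted_setD_below U r v : rooted U r -> v \in U -> v != r ->
  rooted (U :\: below U v) r.
Proof.
move=> rUr vU vr; have := below_root rUr vU vr; have [rU toroot par] := rUr.
move=> rnv; split; first by rewrite inE rnv.
  by move=> x; rewrite inE => /andP[_ /toroot].
move=> x; rewrite !inE negb_and => /andP[xnv xU] xr; rewrite xU /= in xnv.
have [p pU xp] := par x xU xr; exists p => //; rewrite !inE pU andbT /=.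
by apply: contra xnv; apply: connect_trans (connect1 xp).
Qed.

Lemma rooted_child U r x : rooted U r -> x \in U -> x != r ->
  exists2 c, c \in children U r & connect edge x c.
Proof.
move=> [_ toroot par] xU; have /connectP[p] := toroot x xU.
elim: p x xU => [|y p IH] x xU /= => [_ <-|]; first by rewrite eqxx.
case/andP=> xy yp ylast xr; have [z zU xz] := par x xU xr.
have yz := out_unique xy xz; rewrite -{}yz {z} in zU xz.
have [yr|ynr] := eqVneq y r; first by exists x; rewrite ?inE ?xU -?yr.
have [c cr yc] := IH y zU yp ylast ynr; exists c => //.
exact: connect_trans (connect1 xy) yc.
Qed.

Lemma children_exist U r : rooted U r -> U != [set r] -> exists c, c \in children U r.
Proof.
move=> rUr Unr; have [rU _ _] := rUr.
suff /existsP[x /andP[xU xr]] : [exists x, (x \in U) && (x != r)].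
  by have [c cr _] := rooted_child rUr xU xr; exists c.
apply: contraR Unr => /existsPn Ur; apply/eqP/setP => x; rewrite inE.
have := Ur x; rewrite negb_and negbK.
by case: eqP => [->|_]; rewrite ?rU // orbF => /negPf.
Qed.

(** * Cutting a tree along an edge *)

Definition opens U r K := exists2 B : {set G},
  children U r \subset B & connect (small_move (U :\ r) K) set0 B.

(** The count in [opens] leaves out the pebble later put on the root. The clause [0 < K] guards
    against the truncation of [K.-1] at zero. *)
Definition splits U r K := exists v,
  [/\ 0 < K, v \in U, v != r, opens (below U v) v K.-1
    & opens (U :\: below U v) r K.-1].

Lemma split_visit U r K : rooted U r -> U != [set r] ->
  forall (Q : nat -> {set G}) N, Q 0 = set0 -> children U r \subset Q N ->
  (forall t, t < N -> lazy_move (U :\ r) (Q t) (Q t.+1)) ->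
  (forall t, t <= N -> Q t \subset U :\ r) ->
  (forall t, t <= N -> #|Q t| <= K) ->
  splits U r K.
Proof.
(* Strong induction on the total pebble count replaces the choice of a minimal visit. *)
move=> rUr Unr Q N; have [m] := ubnP (\sum_(t < N.+1) #|Q t|).
elim: m Q => // m IH Q lt_m Q0 QN mv sub sm.
have [rU toroot par] := rUr.
(* [s] is the last time at which nothing is pebbled. *)
have [s sP smax] := @ex_maxnP (fun t => (t <= N) && (Q t == set0)) N
  (ex_intro _ 0 (introT andP (conj (leq0n N) (introT eqP Q0))))
  (fun t => fun tP => proj1 (andP tP)).
move: sP => /andP[sN /eqP Qs].
have {}sN : s < N.
  rewrite ltn_neqAle sN andbT; apply/eqP => sN'.
  have [c cr] := children_exist rUr Unr.
  by have := subsetP QN c cr; rewrite -sN' Qs inE.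
have Qgt t : s < t -> t <= N -> Q t != set0.
  by move=> st tN; apply: contraL st => Qt; rewrite -leqNgt smax // tN.
(* The move out of the empty position finds no in-neighbour pebbled, so it places a pebble on a
   leaf. *)
have [l [lU lr Ql lin]] : exists l, [/\ l \in U, l != r, Q s.+1 = [set l]
    & forall u, u \in U -> ~~ edge u l].
  have /orP[/eqP Qs1|/move_inP[l [lW Ql inl]]] := mv s sN.
    by have := Qgt s.+1 (leqnn _) sN; rewrite -Qs1 Qs eqxx.
  move: (lW); rewrite !inE => /andP[lr lU]; exists l; split=> //.
    by apply/setP => y; rewrite Ql Qs !inE.
  move=> u uU; apply/negP => ul; have := inl u; rewrite !inE uU Qs inE andbT.
  have [ur|_] := eqVneq u r; last by move=> /(_ isT ul).
  by have := edge_connect_false ul; rewrite ur toroot.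
have K0 : 0 < K by rewrite (leq_trans _ (sm _ sN)) // Ql cards1.
(* By minimality of the total number of pebbles, no restriction of the visit to a
   proper part of the tree during [s, c] is again a visit. *)
have shrink X c t : s <= t <= c -> c <= N -> Q c \subset X -> ~~ (Q t \subset X) ->
    (forall i, s <= i < c -> lazy_move (U :\ r) (Q i :&: X) (Q i.+1 :&: X)) ->
    splits U r K.
  move=> /andP[st tc] cN QcX QtX mvX.
  (* The restriction agrees with [Q] at [s] and at [c], so it splices into the visit; time [t] makes
     the sum strictly smaller. *)
  pose Q' i := if s <= i <= c then Q i :&: X else Q i.
  have Q'sub i : Q' i \subset Q i by rewrite /Q'; case: ifP; rewrite ?subsetIl.
  have tN := leq_trans tc cN.
  have sQ : Q' s = Q s by rewrite /Q' leqnn (leq_trans st tc) Qs set0I.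
  have cQ : Q' c = Q c.
    by rewrite /Q' leqnn (leq_trans st tc) //=; apply/setIidPl.
  apply: (IH Q') => //.
  - rewrite ltnS in lt_m; apply: leq_trans lt_m.
    rewrite (bigD1 (Ordinal (tN : t < N.+1))) //=.
    rewrite [X in _ < X](bigD1 (Ordinal (tN : t < N.+1))) //=.
    rewrite -addSn leq_add ?leq_sum // => [|i _]; last exact: subset_leq_card.
    by rewrite proper_card // /Q' st tc /= properIl.
  - by apply/eqP; rewrite -subset0 -Q0.
  - have [Nc|Nc] := eqVneq c N; first by rewrite -Nc cQ Nc.
    by rewrite /Q' andbC leqNgt ltn_neqAle Nc cN.
  - move=> i iN; have [ic|ci] := ltnP i c; last first.
      have -> : Q' i.+1 = Q i.+1 by rewrite /Q' [i.+1 <= c]leqNgt ltnS ci andbF.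
      have [eci|nci] := eqVneq c i; first by rewrite -eci cQ eci mv.
      rewrite /Q' [i <= c]leqNgt ltn_neqAle nci ci andbF; exact: mv.
    rewrite /Q' ic (ltnW ic) !andbT; have [si|lt_is] := leqP s i.
      by rewrite leqW // mvX // si.
    have [ise|nis] := eqVneq s i.+1.
      by move: (mv i iN); rewrite -ise leqnn Qs set0I.
    by rewrite leq_eqVlt (negPf nis) ltnS leqNgt lt_is /= mv.
  - by move=> i iN; apply: subset_trans (Q'sub i) (sub i iN).
  - by move=> i iN; apply: leq_trans (subset_leq_card (Q'sub i)) (sm i iN).
have [v [vU lv good vmin]] : exists v, [/\ v \in U, connect edge l v,
    forall t, s < t -> t <= N -> Q t :&: below U v != set0
    & forall w, w \in children U v -> connect edge l w ->
        exists2 b, s < b <= N & Q b :&: below U w = set0].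
  (* The root is good, so there is a good vertex with the fewest vertices below it; none of its
     children above [l] is good. *)
  pose good v := [&& v \in U, connect edge l v
    & [forall t : 'I_N.+1, (s < t) ==> (Q t :&: below U v != set0)]].
  have good_r : good r.
    rewrite /good rU toroot //=; apply/forall_inP => t st.
    have /set0Pn[x xQ] := Qgt t st (ltn_ord t); apply/set0Pn; exists x.
    have := subsetP (sub t (ltn_ord t)) x xQ; rewrite !inE xQ => /andP[_ xU].
    by rewrite xU toroot.
  case: (arg_minnP (fun v => #|below U v|) good_r) => v /and3P[vU lv /forall_inP Qv] vmin.
  exists v; split=> // [t st tN|w]; first exact: (Qv (Ordinal (tN : t < N.+1))).
  rewrite inE => /andP[wU wv] lw.
  have : ~~ good w.
    apply/negP => /vmin; rewrite leqNgt; case/negP; apply/proper_card/properP; split.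
      apply/subsetP => y; rewrite !inE => /andP[-> /= yw].
      exact: connect_trans yw (connect1 wv).
    by exists v; rewrite !inE vU ?connect0 //= edge_connect_false.
  rewrite /good wU lw /= negb_forall => /existsP[t].
  rewrite negb_imply negbK => /andP[st /eqP Qtw].
  by exists t => //; rewrite st -ltnS ltn_ord.
have Q1v : Q s.+1 :\: below U v = set0.
  by apply/eqP; rewrite setD_eq0 Ql sub1set !inE lU.
have F_sub : v != r -> below U v :\ v \subset U :\ r.
  move=> vr; apply/subsetP => y; rewrite !inE => /and3P[_ yU yv]; rewrite yU andbT.
  have := below_root rUr vU vr; rewrite !inE rU /=.
  by apply: contraNneq => <-.
have F_closed y u : y \in below U v :\ v -> u \in U -> edge u y -> u \in below U v :\ v.
  rewrite !inE => /and3P[_ yU yv] uU uy; rewrite uU (connect_trans (connect1 uy)) // !andbT.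
  by apply: contraTneq uy => ->; apply: contraL yv => /edge_connect_false.
(* The visit is restricted from [s.+1] on, when the outer part is still empty. From then on
   [below U v] always holds one of the [K] pebbles. *)
have rest : v != r -> opens (U :\: below U v) r K.-1.
  move=> vr; exists (Q N :\: below U v).
    apply/subsetP => y; rewrite !inE => /andP[/andP[ynv yU] yr]; rewrite ynv.
    by apply: (subsetP QN); rewrite inE yU.
  have UE t : t <= N -> Q t :\: below U v = Q t :&: ((U :\: below U v) :\ r).
    move=> tN; apply/setP => y; have := subsetP (sub t tN) y; rewrite !inE.
    by case: (y \in Q t); rewrite ?andbF //= => /(_ isT)/andP[-> ->]; rewrite !andbT.
  rewrite -Q1v; apply: (lazy_moves_connect (Q := fun t => Q t :\: below U v)) => //.
    move=> t /andP[_ tN]; rewrite !UE ?(ltnW tN) //.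
    apply: lazy_moveI (mv t tN) _ => z zW zX _; split=> // u uX _; rewrite uX andbT.
    by move: uX; rewrite !inE => /and3P[-> _ ->].
  move=> t /andP[st tN]; rewrite -ltnS.
  rewrite prednK // (leq_trans _ (sm t tN)) // -[X in _ < X](cardsID (below U v)).
  by rewrite -{1}[#|Q t :\: _|]add0n ltn_add2r card_gt0 good.
(* If [v] is the leaf [l], it has no children and the empty position suffices. *)
have [elv|nlv] := eqVneq l v.
  rewrite -elv in vU rest *; exists l; split=> //; last exact: rest.
  exists set0; rewrite ?connect0 //; apply/subsetP => u.
  by rewrite !inE => /andP[/andP[uU _]]; rewrite (negPf (lin u uU)).
have lb : l \in below U v by rewrite !inE lU.
have [w wch lw] := rooted_child (rooted_below rUr vU) lb nlv.
move: wch; rewrite !inE => /andP[/andP[wU _] wv].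
(* [b] is the first time after [s] at which the subtree of [w] is empty again. *)
have [b bP bmin] : exists2 b, s < b <= N /\ Q b :&: below U w = set0
    & forall t, s < t < b -> Q t :&: below U w != set0.
  have exb : exists b, (s < b <= N) && (Q b :&: below U w == set0).
    have [|b sb Qb] := vmin w _ lw; first by rewrite inE wU.
    by exists b; rewrite sb Qb eqxx.
  case: (ex_minnP exb) => b /andP[/andP[sb bN] /eqP Qb] bmin.
  exists b; first by rewrite sb.
  move=> t /andP[st tb]; apply/negP => Qt.
  by have := bmin t; rewrite st Qt (leq_trans (ltnW tb) bN) leqNgt tb => /(_ isT).
pose Z := U :&: ~: below U w.
have lw' : l \in below U w by rewrite !inE lU.
have below_w_closed z u : edge u z -> u \in below U w -> z \in U -> z != v -> z \in below U w.
  rewrite !inE => uz /andP[_ uw] -> zv /=; apply: (connect_parent uw _ uz).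
  by apply: contraNneq zv => euw; rewrite euw in uz; rewrite (out_unique uz wv).
case: bP => /andP[sb bN] Qb.
(* If [v] carries no pebble throughout [[s, b]], no move there outside the subtree of [w] depends on
   that subtree, and [shrink] erases it. *)
have [/existsP[t0 /andP[/andP[st0 t0b] vt0]]|nov] :=
    boolP [exists t : 'I_N.+1, (s <= t <= b) && (v \in Q t)]; last first.
  apply: (shrink (~: below U w) b s.+1) => //; first by rewrite leqnSn.
  - by rewrite -disjoints_subset -setI_eq0 Qb.
  - by rewrite Ql sub1set inE lw'.
  move=> t /andP[st tb]; have tN := leq_trans tb bN.
  apply: lazy_moveI (mv t tN) _ => z zW zX mvz; split=> // u uW uz.
  rewrite uW inE; apply: contraL zX => uw; rewrite inE negbK.
  apply: below_w_closed uz uw _ _; first by move: zW; rewrite inE => /andP[].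
  apply: contraNneq mvz => zv; move/existsPn: nov => nov.
  have := nov (Ordinal (ltnW tN : t < N.+1)); have := nov (Ordinal (tN : t.+1 < N.+1)).
  by rewrite /= zv st (ltnW tb) tb leqW //= => /negPf-> /negPf->.
have vr : v != r.
  by have := subsetP (sub t0 (ltn_ord t0)) v vt0; rewrite !inE => /andP[].
pose F := below U v :\ v; have {}F_sub := F_sub vr.
(* The first time from [s] on at which [v] is pebbled is [u.+1]; it comes after [s], where nothing
   is pebbled. *)
have exu : exists t, (s <= t <= b) && (v \in Q t) by exists t0; rewrite st0 t0b.
case: (ex_minnP exu) => [[|u]] /andP[/andP[su ub] vQu] umin.
  by move: su; rewrite leqn0 => /eqP s0; rewrite -s0 Qs inE in vQu.
have {}su : s <= u.
  move: su; rewrite leq_eqVlt => /predU1P[su|//].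
  by rewrite -su Qs inE in vQu.
have vQu' : v \notin Q u.
  by apply/negP => vQ; have := umin u; rewrite su ltnW // vQ ltnn => /(_ isT).
(* [x] is the last time at which all pebbles lie strictly below [v]. *)
have exx : exists t, (s <= t <= N) && (Q t \subset F).
  by exists s; rewrite leqnn ltnW //= Qs sub0set.
have [x /andP[/andP[sx xN] QxF] xmax] := ex_maxnP exx
  (fun t tP => proj2 (andP (proj1 (andP tP)))).
(* If a pebble leaves [F] between [s] and [x], [shrink] applies with [F], which is closed under
   in-neighbours within [U]. Otherwise [v] is placed only after [x]. *)
have [/existsP[t1 /andP[/andP[st1 t1x] Qt1]]|inF] :=
    boolP [exists t : 'I_N.+1, (s <= t <= x) && ~~ (Q t \subset F)].
  apply: (shrink F x t1) => //; first by rewrite st1.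
  move=> t /andP[st tx]; have tN := leq_trans tx xN.
  apply: lazy_moveI (mv t tN) _ => z zW zF _; split=> // y yW yz; rewrite yW /=.
  by apply: (F_closed z) => //; move: yW; rewrite inE => /andP[].
have xu : x <= u.
  rewrite leqNgt; apply/negP => ux; move/existsPn: inF => inF.
  have := inF (Ordinal (leq_trans ux xN : u.+1 < N.+1)); rewrite /= ux leqW // negbK.
  by move/subsetP => /(_ v vQu); rewrite !inE eqxx.
(* After [x] at least one pebble lies outside [F]. *)
have after t : x < t -> t <= N -> #|Q t :&: F| <= K.-1.
  move=> xt tN.
  rewrite -ltnS prednK // (leq_trans _ (sm t tN)) // proper_card // properIl //.
  apply/negP => QtF; have := xmax t.
  by rewrite QtF tN (leq_trans sx (ltnW xt)) leqNgt xt => /(_ isT).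
exists v; split=> //; last exact: rest.
(* At time [u.+1] the vertex [v] has just been placed, so all its children are pebbled. *)
exists (Q u.+1 :&: F).
  apply/subsetP => c; rewrite !inE => /andP[/andP[cU cv] ecv].
  have cr : c != r.
    by apply: contraTneq ecv => ->; apply: contraL (toroot v vU) => /edge_connect_false.
  have uN := leq_trans ub bN.
  have cQ : c \in Q u.
    by apply: (lazy_move_in (mv u uN) vQu' vQu _ ecv); rewrite !inE cr.
  rewrite (edge_neq ecv) cU cv !andbT.
  have /orP[/eqP<- //|/move_inP[z [_ Qz _]]] := mv u uN.
  have : v \in Q u.+1 by [].
  rewrite Qz (negPf vQu') /= => /eqP vz.
  by rewrite Qz cQ -vz (negPf (edge_neq ecv)).
have stepF (X X' : {set G}) t : X \subset X' -> X' \subset F -> t < N ->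
    (forall z y, z \in X -> y \in X' -> edge y z -> y \in X) ->
    lazy_move X' (Q t :&: X) (Q t.+1 :&: X).
  move=> XX' X'F tN clX; apply: lazy_moveI (mv t tN) _ => z zW zX _.
  split=> [|y yX' yz]; first exact: (subsetP XX').
  by rewrite (subsetP F_sub) ?(subsetP X'F) //= (clX z).
have Qb' : Q b :&: (F :\: below U w) = Q b :&: F.
  apply/setP => y; rewrite inE in_setD [in RHS]inE.
  case: (boolP (y \in below U w)) => //= yw; rewrite andbF.
  have : y \notin Q b :&: below U w by rewrite Qb inE.
  by rewrite inE yw andbT => /negPf->.
(* The first leg runs forward from [s] to [b] without the subtree of [w], which holds a pebble
   strictly in between. The second runs backward from [b] to [u.+1] in all of [F]. They meet at [b],
   where that subtree is empty. *)
apply: (@connect_trans _ _ (Q b :&: F)).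
  have -> : set0 = Q s :&: (F :\: below U w) by rewrite Qs set0I.
  rewrite -Qb'; apply: (lazy_moves_connect (Q := fun t => Q t :&: (F :\: below U w))).
  - by rewrite ltnW.
  - move=> t /andP[st tb]; apply: stepF; rewrite ?subsetDl ?(leq_trans tb) //.
    move=> z y; rewrite !in_setD => /andP[znw zF] yF yz; rewrite yF andbT.
    apply: contra znw => yw; apply: (below_w_closed z y) => //.
      by move: zF; rewrite !inE => /and3P[].
    by move: zF; rewrite !inE => /and3P[].
  move=> t /andP[st tb].
  have [ets|nts] := eqVneq t s; first by rewrite ets Qs set0I cards0.
  have [->|ntb] := eqVneq t b.
    by rewrite Qb' after // (leq_ltn_trans xu).
  have {}st : s < t by rewrite ltn_neqAle eq_sym nts.
  have {}tb : t < b by rewrite ltn_neqAle ntb.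
  have tN : t <= N := leq_trans (ltnW tb) bN.
  rewrite -ltnS prednK // (leq_trans _ (sm t tN)) // proper_card // properIl //.
  have /set0Pn[y] : Q t :&: below U w != set0 by rewrite bmin // st.
  rewrite inE => /andP[yQ yw]; apply/negP => /subsetP/(_ y yQ).
  by rewrite inE yw.
rewrite small_connectC.
apply: (lazy_moves_connect (Q := fun t => Q t :&: F)) => // t /andP[ut tb].
  by apply: stepF; rewrite ?(leq_trans tb).
by apply: after; [exact: leq_ltn_trans xu ut | exact: leq_trans tb bN].
Qed.

(** * Recursive pebbling strategies *)

Lemma opens_split U r K : rooted U r -> U != [set r] -> opens U r K -> splits U r K.
Proof.
move=> rUr Unr [B chB /small_connect_moves[Q [N [Q0 QN mv sub sm]]]].
by apply: (@split_visit U r K rUr Unr Q N) => //; rewrite QN.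
Qed.

(** First pebble [v], next pebble [r] while [v] stays pebbled, then undo the first phase while [r]
    stays pebbled. At most one pebble stands idle in each phase. *)
Lemma pebbling_split U r v k n n' : rooted U r -> v \in U -> v != r ->
  pebbling (below U v) k n set0 [set v] ->
  pebbling (U :\: below U v) k n' set0 [set r] ->
  pebbling U k.+1 (n + n' + n) set0 [set r].
Proof.
move=> rUr vU vr pv pr; have rnv := below_root rUr vU vr.
have subU : below U v \subset U by apply: subsetIl.
have closed Z z u : z \in below U v -> u \in U -> edge u z -> (u \in below U v) || (u \in Z).
  by rewrite !inE => /andP[_ zv] -> /connect1/connect_trans->.
have up : pebbling U k.+1 n set0 [set v].
  have := pebbling_lift subU _ (closed set0) pv; rewrite cards0 !set0U.
  move=> /(_ _)/pebbling_leq; apply=> //.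
  by rewrite -setI_eq0 setI0.
have across : pebbling U k.+1 n' [set v] [set v; r].
  have := pebbling_lift (subsetDl U (below U v)) _ _ pr.
  move=> /(_ [set v]); rewrite cards1 setU0; apply.
    by rewrite disjoint_sym disjoints1 !inE vU connect0.
  move=> z u; rewrite !in_setD in_set1 => /andP[zv zU] uU uz; rewrite uU andbT orbC.
  have [//|unv] := eqVneq u v; move: zv; rewrite !inE zU uU /=.
  by apply: contra => uv; apply: connect_parent uv unv uz.
have down : pebbling U k.+1 n [set v; r] [set r].
  have := pebbling_lift subU _ (closed [set r]) (pebblingC pv).
  rewrite cards1 setU0 setUC; apply.
  by rewrite disjoint_sym disjoints1.
exact: pebbling_trans (pebbling_trans up across) down.
Qed.

Lemma pebbling1 r : pebbling [set r] 1 1 set0 [set r].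
Proof.
exists [:: [set r]]; split; rewrite //= ?cards0 ?cards1 // andbT.
apply/move_inP; exists r; split=> [|y|u]; rewrite !inE //.
by move=> /eqP->; apply: contraTT => _; apply: edge_irrefl.
Qed.

(** Both sides of the cut open with one pebble less, and [pebbling_split] runs one side twice and
    the other once, whence the factor 3. For [K = 0] there is no split, so [U] is a single
    vertex. *)
Lemma opens_pebbling U r K : rooted U r -> opens U r K ->
  pebbling U K.+1 (3 ^ K) set0 [set r].
Proof.
elim: K U r => [|K IH] U r rUr oUr.
  have [->|Unr] := eqVneq U [set r]; first exact: pebbling1.
  by have [v []] := opens_split rUr Unr oUr.
have [->|Unr] := eqVneq U [set r].
  by apply: pebbling_leq (pebbling1 r); rewrite ?expn_gt0.
have [v [_ vU vr ov or]] := opens_split rUr Unr oUr.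
have -> : 3 ^ K.+1 = 3 ^ K + 3 ^ K + 3 ^ K by rewrite expnS !mulSn addn0 addnA.
apply: (pebbling_split rUr vU vr); apply: IH => //.
  exact: rooted_below rUr vU.
exact: rooted_setD_below.
Qed.

(** Cutting off the subtree of a child [c] lowers the sum of [d * phi] at the root and its number of
    children on both sides: one side loses the child [c], and on the other the drop of [phi] pays
    for up to [d] children. *)
Lemma pebbling_height (phi : G -> nat) d U r k : rooted U r ->
  (forall c v, edge c v -> phi c < phi v) -> (forall v, #|[set c | edge c v]| <= d) ->
  0 < k -> d * phi r + #|children U r| < k + d -> exists n, pebbling U k n set0 [set r].
Proof.
move=> + phi_edge deg; have [m] := ubnP #|U|.
elim: m U r k => // m IH U r k; rewrite ltnS => Um rUr k0 kphi.
have [->|Unr] := eqVneq U [set r].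
  by exists 1; apply: pebbling_leq (pebbling1 r).
have [rU _ _] := rUr; have [c cch] := children_exist rUr Unr.
have := cch; rewrite inE => /andP[cU cr].
have cnr := edge_neq cr.
have ch_le : #|children (below U c) c| <= d.
  apply: leq_trans (deg c); apply: subset_leq_card.
  by apply/subsetP => y; rewrite !inE => /andP[].
have chD : children (U :\: below U c) r \subset children U r :\ c.
  apply/subsetP => y; rewrite !inE negb_and => /andP[/andP[yc yU] ->].
  rewrite yU /= !andbT in yc *; apply: contraNneq yc => ->; exact: connect0.
have {}chD := subset_leq_card chD.
have chE : #|children U r| = (#|children U r :\ c|).+1 by rewrite (cardsD1 c) cch.
have phic : d * phi c + d <= d * phi r by rewrite -mulnSr leq_mul2l phi_edge ?orbT.
have d0 : 0 < d by apply: leq_trans (deg r); apply/card_gt0P; exists c; rewrite inE.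
case: k k0 kphi => // k _ kphi.
have [n pc] : exists n, pebbling (below U c) k n set0 [set c].
  apply: IH.
  - apply: leq_trans Um; apply: proper_card; apply/properP; split; first exact: subsetIl.
    by exists r => //; apply: below_root.
  - exact: rooted_below rUr cU.
  - lia.
  - lia.
have [n' pr] : exists n, pebbling (U :\: below U c) k n set0 [set r].
  apply: IH.
  - apply: leq_trans Um; apply: proper_card; apply/properP; split; first exact: subsetDl.
    by exists c => //; rewrite !inE cU connect0.
  - exact: rooted_setD_below.
  - lia.
  - lia.
by exists (n + n' + n); apply: pebbling_split pc pr.
Qed.

(** * Persistent pebblings of the whole dag *)

Lemma connect_sink v : connect edge v (sink : G).
Proof.
(* Along an edge the number of ancestors in the sense of [connect edge u y] grows, so a maximizer
   [y] reachable from [v] has no out-edge. *)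
case: (@arg_maxnP _ v (fun y => connect edge v y) (fun y => #|[set u | connect edge u y]|)).
  exact: connect0.
move=> y vy ymax; have [<-//|ys] := eqVneq y sink.
have /existsP[w yw] : [exists w, edge y w].
  by apply: contraR ys => /existsPn yw; apply/eqP/dag_unique_sink.
have /negP[] : ~~ (#|[set u | connect edge u y]| < #|[set u | connect edge u w]|).
  by rewrite -leqNgt; apply: ymax; apply: connect_trans vy (connect1 yw).
apply/proper_card/properP; split.
  by apply/subsetP => u; rewrite !inE => /connect_trans; apply; apply: connect1.
by exists w; rewrite !inE ?connect0 // edge_connect_false.
Qed.

Lemma rooted_setT : rooted setT (sink : G).
Proof.
split=> // [v _|v _ vs]; first exact: connect_sink.
have /existsP[w yw] : [exists w, edge v w].
  by apply: contraR vs => /existsPn yw; apply/eqP/dag_unique_sink.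
by exists w.
Qed.

(** After the sink is pebbled for the last time it takes up one pebble. Read backwards, this final
    phase leads from no other pebbles to all in-neighbours of the sink being pebbled. *)
Lemma persistent_opens (P : seq {set G}) : persistent_pebbling P ->
  opens setT sink (pebbles P).-1.
Proof.
case: P => // A p /and3P[/eqP-> {A}]; set k := pebbles _.
move=> /(pathP set0) mv /eqP p_last.
pose Q := nth set0 (set0 :: p); pose N := size p.
have QN : Q N = [set sink] by rewrite /Q nth_last.
have Qk t : t <= N -> #|Q t| <= k.
  move=> tN; apply: (@leq_bigmax_seq _ _ xpredT (fun A : {set G} => #|A|)) => //.
  by rewrite mem_nth.
have ex0 : exists t, (t <= N) && (sink \notin Q t) by exists 0; rewrite inE.
have [s /andP[sN sinks] smax] := ex_maxnP ex0 (fun t tP => proj1 (andP tP)).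
have {}sN : s < N.
  by rewrite ltn_neqAle sN andbT; apply: contraNneq sinks => ->; rewrite QN inE.
have after t : s < t -> t <= N -> sink \in Q t.
  by move=> st tN; apply: contraLR st => sQ; rewrite -leqNgt smax // tN.
have {}mv t : t < N -> lazy_move setT (Q t) (Q t.+1).
  by move=> tN; apply/orP; right; rewrite -pebble_moveE; apply: mv.
exists (Q s.+1 :\ sink).
  apply/subsetP => c; rewrite !inE /= => cs; rewrite (edge_neq cs) /=.
  have cQ : c \in Q s by apply: (lazy_move_in (mv s sN) sinks (after _ _ sN) _ cs).
  have /orP[/eqP<- //|/move_inP[z [_ Qz _]]] := mv s sN.
  have := after s.+1 (leqnn _) sN; rewrite Qz (negPf sinks) /= => /eqP sz.
  by rewrite Qz cQ -sz (negPf (edge_neq cs)).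
rewrite small_connectC.
have -> : set0 = Q N :\ sink by rewrite QN setDv.
have QE t : Q t :\ sink = Q t :&: (setT :\ sink) by rewrite setTD -setDE.
apply: (lazy_moves_connect (Q := fun t => Q t :\ sink)) => // t /andP[st tN].
  rewrite !QE; apply: lazy_moveI (mv t tN) _ => z _ zX _; split=> // u ->.
  by rewrite inE.
have := Qk t tN; rewrite (cardsD1 sink) after // add1n.
by move: k {Qk} => [|k].
Qed.

(** [steps] counts positions rather than moves, hence [n.+1]. *)
Lemma pebbling_persistent k n : pebbling setT k n set0 [set (sink : G)] ->
  exists P : seq {set G}, [/\ persistent_pebbling P, pebbles P <= k & steps P <= n.+1].
Proof.
move=> [p [mv pl sm sz]]; exists (set0 :: p); split=> //.
  by rewrite /= eqxx pl eqxx andbT; apply: sub_path mv => A B; rewrite pebble_moveE.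
apply/bigmax_leqP_seq => A Ap _; exact: (allP sm).
Qed.

Lemma pebbles_gt0 (P : seq {set G}) : persistent_pebbling P -> 0 < pebbles P.
Proof.
case: P => // A p /and3P[_ _ /eqP pl]; rewrite -(cards1 (sink : G)) -pl.
by apply: (@leq_bigmax_seq _ _ xpredT (fun A : {set G} => #|A|)); rewrite // mem_last.
Qed.

(** An optimal pebbling gives a visit of [setT]; rebuilding from it by [opens_pebbling] uses no more
    pebbles, and minimality gives equality. *)
Lemma optimal_persistent : exists P : seq {set G}, [/\ persistent_pebbling P,
  pebbles P = rev_number G & steps P <= (3 ^ (rev_number G).-1).+1].
Proof.
have [[P PP Pk] rev_min] := rev_numberP G.
have [P' [P'P P'k P's]] :=
  pebbling_persistent (opens_pebbling rooted_setT (persistent_opens PP)).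
rewrite (prednK (pebbles_gt0 PP)) Pk in P'k; exists P'; split=> //; last by rewrite -Pk.
by apply/eqP; rewrite eqn_leq P'k rev_min.
Qed.

Lemma rev_number_leq (phi : G -> nat) d :
  (forall c v, edge c v -> phi c < phi v) -> (forall v, #|[set c | edge c v]| <= d) ->
  rev_number G <= (d * phi sink).+1.
Proof.
move=> phi_edge deg; have [_ rev_min] := rev_numberP G.
have [|n /pebbling_persistent[P [PP Pk _]]] :=
    @pebbling_height phi d setT sink (d * phi sink).+1 rooted_setT phi_edge deg isT.
  rewrite addSn ltnS leq_add2l; apply: leq_trans (deg sink).
  by apply: subset_leq_card; apply/subsetP => c; rewrite !inE.
exact: leq_trans (rev_min P PP) Pk.
Qed.

End Trees.

(** * Complete binary trees *)

Section CompleteBinaryTree.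
Variable h : nat.
Implicit Types c v w : Bt h.

Lemma Bt_out_unique v w w' : edge v w -> edge v w' -> w = w'.
Proof.
by move=> /existsP[b /eqP vE] /existsP[b' /eqP]; rewrite vE => -[_ /val_inj].
Qed.

Lemma Bt_edge_size c v : edge c v -> size (val c) = (size (val v)).+1.
Proof. by case/existsP=> b /eqP->. Qed.

Lemma Bt_in_degree v : #|[set c : Bt h | edge c v]| <= 2.
Proof.
have inj : {in [set c : Bt h | edge c v] &, injective (fun c => head false (val c))}.
  move=> c c'; rewrite !inE => /existsP[b /eqP cE] /existsP[b' /eqP c'E].
  by rewrite cE c'E /= => bb'; apply: val_inj; rewrite cE c'E bb'.
by rewrite -(card_in_imset inj) -card_bool max_card.
Qed.

Lemma rev_number_Bt : rev_number (Bt h) <= (2 * h.-1).+1.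
Proof.
(* [phi] is the height of [v] above the deepest level. *)
pose phi v := h.-1 - size (val v).
have -> : h.-1 = phi sink by rewrite /phi subn0.
apply: rev_number_leq Bt_in_degree; first exact: Bt_out_unique.
move=> c v /Bt_edge_size cv; rewrite /phi cv subnS prednK // subn_gt0 -cv.
exact: (valP c).
Qed.

End CompleteBinaryTree.

Lemma Bt_optimal_polynomial h : 1 < h -> exists P : seq {set Bt h},
  [/\ persistent_pebbling P, pebbles P = rev_number (Bt h)
    & steps P <= (2 ^ h - 1) ^ 8].
Proof.
case: h => [|[|m]] // _.
have [P [PP Pk Ps]] := optimal_persistent (@Bt_out_unique m.+2).
exists P; split=> //; apply: leq_trans Ps _.
have rev_le : (rev_number (Bt m.+2)).-1 <= 2 * m.+1.
  by have /= := rev_number_Bt m.+2; case: rev_number.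
(* The exponent 8 works since [3 ^ 2 < 2 ^ 8] and [2 ^ m.+1 <= 2 ^ m.+2 - 1]; the strict inequality
   absorbs the extra position. *)
apply: (@leq_ltn_trans (3 ^ (2 * m.+1))); first by rewrite leq_exp2l.
apply: (@leq_trans ((2 ^ m.+1) ^ 8)).
  by rewrite (expnM 3) -[(2 ^ _) ^ 8]expnM mulnC expnM ltn_exp2r.
rewrite leq_exp2r // (expnS 2 m.+1) mul2n -addnn -addnBA ?expn_gt0 //.
exact: leq_addr.
Qed.

(** * The bound in terms of [n] *)

Local Open Scope ring_scope.

Theorem mainTheorem8 (R : realType) :
  exists C : R, 0 < C /\
  exists h0 : nat, forall h : nat, (h0 <= h)%N ->
    let n : R := (2 ^ h - 1)%N%:R in
    exists P : seq {set Bt h},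
      [/\ persistent_pebbling P,
          pebbles P = rev_number (Bt h) &
          (steps P)%:R <= n `^ (C * ln (ln n))].
Proof.
(* Once [n] is at least [e2], [ln (ln n)] is at least 1, and the exponent 8 of the polynomial bound
   serves as [C]. *)
pose e2 : R := expR (expR 1).
exists 8%:R; split; first by rewrite ltr0n.
(* [Num.bound e2] forces [n] above [e2], and the two successors give [1 < h]. *)
exists (Num.bound e2).+2 => h hh n.
have [P [PP Pk Ps]] := @Bt_optimal_polynomial h (leq_trans (isT : 1 < _.+2)%N hh).
exists P; split=> //.
have le_e2 : e2 <= n.
  apply: (le_trans (ltW (archi_boundP (expR_ge0 _)))).
  rewrite ler_nat leq_subRL ?expn_gt0 //.
  by rewrite add1n (leq_trans _ (ltnW (ltn_expl h _))) // ltnW.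
have e2_gt0 : 0 < e2 := expR_gt0 _.
have n_gt0 : 0 < n := lt_le_trans e2_gt0 le_e2.
have ln_n : expR 1 <= ln n by rewrite -[expR 1]expRK ler_ln ?posrE.
have lnln : 1 <= ln (ln n).
  by rewrite -[1]expRK ler_ln ?posrE ?expR_gt0 // (lt_le_trans (expR_gt0 1)).
have n_ge1 : 1 <= n by apply: le_trans le_e2; rewrite /e2 -expR0 ler_expR expR_ge0.
apply: (@le_trans _ _ (n ^+ 8)); first by rewrite -natrX ler_nat.
by rewrite -powR_mulrn ?(ltW n_gt0) //; apply: ler_powR; rewrite // ler_peMr.
Qed.
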